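(* Let $n\ge2$ and let a path on vertices $1,\ldots,n+1$ have positive edge weights $a_1,\ldots,a_n$, where $a_i$ is the weight of the edge joining $i$ and $i+1$. For $1\le i\le j\le n+1$ let $\rho_{i,j}$ denote the spectral radius of the weighted adjacency matrix induced by the interval of vertices $[i,j]$, with $\rho_{i,i}=0$. Then $$\rho_{1,n}\,\rho_{2,n+1}\ \ge\ \rho_{2,n}\,\rho_{1,n+1}.$$
   Context: The weighted adjacency matrix induced by $[i,j]$ is the $(j-i+1)\times(j-i+1)$ symmetric tridiagonal matrix indexed by $i,i+1,\dots,j$ with zero diagonal and with $(m,m+1)$ and $(m+1,m)$ entries equal to $a_m$ for $i\le m\le j-1$. *)

(* Defs.v *)
(* MathComp, with real numbers from MathComp-Analysis ([realType]) and complex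
   numbers [R[i]] from MathComp-real-closed. *)
From HB Require Import structures.
From mathcomp Require Import all_boot all_order all_algebra.
From mathcomp Require Import boolp classical_sets reals.
From mathcomp Require Import complex.

Set Implicit Arguments.
Unset Strict Implicit.
Unset Printing Implicit Defensive.

Import Order.TTheory GRing.Theory Num.Theory.
Local Open Scope ring_scope.
Local Open Scope classical_set_scope.
Local Open Scope complex_scope.

(* The norm [`|z|] of [z : R[i]] is itself an element of [R[i]] (with zero
   imaginary part); its real part is the modulus as a real number. *)
Definition spectral_radius (R : realType) (n : nat) (A : 'M[R]_n) : R :=
  sup [set complex.Re `|z| | z in
         [set z : R[i] | eigenvalue (map_mx (real_complex R) A) z]].

(* For [0 < n] the supremum is attained, i.e. it is a maximum. *)
Lemma spectral_radius_max (R : realType) (n : nat) (A : 'M[R]_n.+1) :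
  (exists2 z : R[i], eigenvalue (map_mx (real_complex R) A) z
                   & complex.Re `|z| = spectral_radius A) /\
  (forall z : R[i], eigenvalue (map_mx (real_complex R) A) z ->
                    complex.Re `|z| <= spectral_radius A).
Proof.
set B := map_mx _ A.
have [rs rsE] := closed_field_poly_normal (char_poly B).
have eigE z : eigenvalue B z = (z \in rs).
  rewrite eigenvalue_root_char rsE rootZ ?root_prod_XsubC//.
  by rewrite lead_coef_eq0 monic_neq0 ?char_poly_monic.
have rs_gt0 : (0 < size rs)%N.
  have := size_char_poly B; rewrite rsE size_scale; last first.
    by rewrite lead_coef_eq0 monic_neq0 ?char_poly_monic.
  by rewrite size_prod_XsubC => -[->].
have [z zrs zmax] : exists2 z, z \in rs &
    {in rs, forall w, complex.Re `|w| <= complex.Re `|z|}.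
  elim: rs rs_gt0 {rsE eigE} => // x [|y s] IH _.
    by exists x; rewrite ?mem_head// => w; rewrite inE => /eqP ->.
  have [z zs zP] := IH isT.
  have [xz|zx] := leP (complex.Re `|x|) (complex.Re `|z|).
    exists z; first by rewrite inE zs orbT.
    by move=> w; rewrite inE => /predU1P[->//|/zP].
  exists x; first exact: mem_head.
  move=> w; rewrite inE => /predU1P[->//|/zP wz].
  exact: le_trans wz (ltW zx).
suff <- : complex.Re `|z| = spectral_radius A.
  by split=> [|w]; [exists z|]; rewrite ?eigE//; apply: zmax.
have zub : ubound [set complex.Re `|w| | w in [set w | eigenvalue B w]]
    (complex.Re `|z|).
  by move=> x [w]; rewrite /= eigE => wrs <-; apply: zmax.
have zin : [set complex.Re `|w| | w in [set w | eigenvalue B w]]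
    (complex.Re `|z|).
  by exists z; rewrite //= eigE.
apply/eqP; rewrite eq_le; apply/andP; split.
  by apply: ub_le_sup => //; exists (complex.Re `|z|).
by apply: ge_sup => //; exists (complex.Re `|z|).
Qed.

(* Edge weight between the vertices [u] and [v] of the path [1 - 2 - 3 - ...],
   where [a m] is the weight of the edge joining [m] and [m.+1]. *)
Definition path_weight (R : realType) (a : nat -> R) (u v : nat) : R :=
  if v == u.+1 then a u else if u == v.+1 then a v else 0.

(* For [i <= j], row and column [p] stand for the vertex [i + p] of [i, j]. *)
Definition path_adj (R : realType) (a : nat -> R) (i j : nat) :
    'M[R]_((j - i).+1) :=
  \matrix_(p, q) path_weight a (i + p) (i + q).

Definition path_rho (R : realType) (a : nat -> R) (i j : nat) : R :=
  spectral_radius (path_adj a i j).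

Lemma path_rho_diag (R : realType) (a : nat -> R) (i : nat) :
  path_rho a i i = 0.
Proof.
rewrite /path_rho; have [[z /eigenvalueP[v vz v0] <-] _] :=
  spectral_radius_max (path_adj a i i).
move: vz; suff -> : path_adj a i i = 0.
  rewrite map_mx0 mulmx0 => /esym/eqP; rewrite scaler_eq0 (negPf v0) orbF.
  by move/eqP->; rewrite normr0.
apply/matrixP => p q; rewrite !mxE /path_weight.
have h (r : 'I_(i - i).+1) : nat_of_ord r = 0%N.
  by case: r => r /=; rewrite subnn ltnS leqn0 => /eqP.
by rewrite !h addn0 ltn_eqF.
Qed.

(* Main.v *)
(** Let [f], [g], [h] be the Perron vectors of the paths [1, n], [2, n+1] and
    [2, n], with eigenvalues [p], [q] and [s].  On [2, n] put [w = f g / h] and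
    extend [w] to the two end vertices so that the eigenvalue inequality
    [A w <= (p q / s) w] holds there.  A discrete Wronskian argument shows that
    [f / h] decreases and [g / h] increases along [2, n], which by Chebyshev's
    rearrangement gives the inequality at the inner vertices.  A positive vector
    with [A w <= y w] bounds the spectral radius of a nonnegative matrix by
    [y]. *)
Require Import Defs.
From mathcomp Require Import all_boot all_order all_algebra.
From mathcomp Require Import reals.
From mathcomp Require Import complex.
From mathcomp Require Import zify ring lra.

Import Order.TTheory GRing.Theory Num.Theory.
Local Open Scope ring_scope.

(** * Bounds on the spectral radius from test vectors *)

(** Take a left eigenvector [v] for [z] and an index [j] maximizing [|v_j| / w_j]. Coordinate [j] of
    the eigenvalue equation, with each [|v_i|] replaced by [F j * w i], gives
    [|z| |v_j| <= y |v_j|]. *)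
Lemma spectral_radius_le (R : realType) (n : nat) (A : 'M[R]_n.+1)
    (w : 'I_n.+1 -> R) (y : R) :
    (forall i j, 0 <= A i j) -> (forall i, 0 < w i) ->
    (forall j, \sum_i w i * A i j <= y * w j) ->
  spectral_radius A <= y.
Proof.
move=> A0 w0 wA.
have [[z /eigenvalueP[v vz v0] <-] _] := spectral_radius_max A.
pose F i := complex.Re `|v 0 i| / w i.
have normE (u : R[i]) : `|u| = (complex.Re `|u|)%:C%C by rewrite RRe_real ?normr_real.
have [j _ jmax] := Order.TotalTheory.arg_maxP F (erefl : xpredT (ord0 : 'I_n.+1)).
have vle i : `|v 0 i| <= (F j * w i)%:C%C.
  by rewrite normE lecR -ler_pdivrMr //; apply: jmax.
have Fj : (F j * w j)%:C%C = `|v 0 j| by rewrite [RHS]normE divfK ?gt_eqF.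
have vj : 0 < `|v 0 j|.
  rewrite normr_gt0; apply: contra v0 => /eqP vj0; apply/eqP/rowP => i.
  apply/eqP; rewrite mxE -normr_eq0 eq_le normr_ge0 andbT.
  by rewrite (le_trans (vle i)) // /F vj0 normr0 /= mul0r mul0r.
have Fj0 : 0 < F j.
  by move: vj; rewrite -Fj ltcR pmulr_lgt0.
rewrite -lecR -normE -(ler_pM2r vj) -normrM.
have -> : z * v 0 j = \sum_i v 0 i * (A i j)%:C%C.
  have /rowP/(_ j) := vz; rewrite !mxE => <-.
  by apply: eq_bigr => i _; rewrite !mxE.
apply: (le_trans (ler_norm_sum _ _ _)).
rewrite -Fj -rmorphM /=.
apply: (@le_trans _ _ (F j * \sum_i w i * A i j)%:C%C).
  rewrite mulr_sumr rmorph_sum /=; apply: ler_sum => i _.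
  rewrite normrM mulrA rmorphM /= [X in _ * X]ger0_norm ?ler0c //.
  by rewrite ler_wpM2r ?ler0c.
by rewrite lecR mulrCA ler_wpM2l // ltW.
Qed.

Lemma le_spectral_radius (R : realType) (n : nat) (A : 'M[R]_n.+1)
    (x : R) (v : 'rV[R]_n.+1) :
  0 <= x -> v != 0 -> v *m A = x *: v -> x <= spectral_radius A.
Proof.
move=> x0 v0 vA; have [_ /(_ x%:C%C)] := spectral_radius_max A.
rewrite ger0_norm ?ler0c //=; apply; apply/eigenvalueP.
exists (map_mx (real_complex R) v); first by rewrite -map_mxM vA map_mxZ.
by rewrite map_mx_eq0.
Qed.

(** * Supersolutions on an interval of the path *)

Section Path.
Variables (R : realType) (a : nat -> R).

Lemma sum_path_weight (u : nat -> R) (i j k : nat) :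
    (0 < i)%N -> (i <= k <= j)%N -> u i.-1 = 0 -> u j.+1 = 0 ->
  \sum_(p < (j - i).+1) u (i + p)%N * path_weight a (i + p) k =
    a k.-1 * u k.-1 + a k * u k.+1.
Proof.
move=> i0 /andP[ik kj] ui uj.
rewrite -(big_mkord xpredT (fun p => u (i + p)%N * path_weight a (i + p) k)).
have -> : (j - i).+1 = (j.+1 - i)%N by rewrite subSn // (leq_trans ik).
under eq_bigr do rewrite addnC.
rewrite -(big_addn 0 j.+1 i xpredT (fun m => u m * path_weight a m k)) add0n.
have -> : \sum_(i <= m < j.+1) u m * path_weight a m k =
    \sum_(i <= m < j.+1 | m == k.-1) a m * u m
      + \sum_(i <= m < j.+1 | m == k.+1) a k * u m.
  rewrite [X in _ = X + _]big_mkcond [X in _ = _ + X]big_mkcond -big_split /=.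
  apply: eq_big_nat => m _; rewrite /path_weight.
  have -> : (m == k.-1) = (k == m.+1) by lia.
  case: (k =P m.+1) => [->|_]; first by rewrite ifF ?addr0 1?mulrC //; lia.
  by case: (m =P k.+1) => _; rewrite add0r ?mulr0 1?mulrC.
(* A neighbour of [k] outside [[i, j]] can only be [i.-1] or [j.+1], where [u] vanishes, so one
   formula also covers the end vertices. *)
rewrite !big_nat1_eq; congr (_ + _); case: ifP => // H.
  by have -> : k.-1 = i.-1 by [lia]; rewrite ui mulr0.
by have -> : k.+1 = j.+1 by [lia]; rewrite uj mulr0.
Qed.

(** Cutting [w] off outside [[i, j]] only drops nonnegative terms from the left-hand sides. Hence a
    Perron vector of a longer path can serve as a test vector for a shorter one. *)
Lemma path_rho_le (i j : nat) (y : R) (w : nat -> R) :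
    (0 < i <= j)%N -> (forall k, (i <= k < j)%N -> 0 < a k) ->
    (forall k, (i <= k <= j)%N -> 0 < w k) ->
    0 <= a i.-1 * w i.-1 -> 0 <= a j * w j.+1 ->
    (forall k, (i <= k <= j)%N ->
      a k.-1 * w k.-1 + a k * w k.+1 <= y * w k) ->
  path_rho a i j <= y.
Proof.
move=> /andP[i0 ij] a0 w0 wi wj wy.
pose w' k := if (i <= k <= j)%N then w k else 0.
have rng (p : 'I_(j - i).+1) : (i <= i + p <= j)%N by have := ltn_ord p; lia.
apply: (@spectral_radius_le _ _ _ (fun p => w' (i + p)%N)).
- move=> p q; rewrite mxE /path_weight; have := rng p; have := rng q.
  by do 2?[case: eqP => ? //] => ? ?; apply/ltW/a0; lia.
- by move=> p; rewrite /w' rng w0.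
move=> q; under eq_bigr do rewrite mxE.
rewrite sum_path_weight //; [|by rewrite /w' ifF //; lia..].
rewrite [X in _ <= y * X]/w' rng; apply: le_trans (wy _ (rng q)).
have := rng q; move: (i + q)%N => k ikj.
apply: lerD; rewrite /w'; case: ifP => // H; rewrite mulr0.
  by have -> : k.-1 = i.-1 by [lia].
by have -> : k = j by lia.
Qed.

(** * Perron vectors of paths from characteristic polynomials *)

(* Characteristic polynomial of the path with [k] vertices whose successive
   edge weights are [b 0], [b 1], ... *)
Fixpoint path_poly (b : nat -> R) (k : nat) : {poly R} :=
  match k with
  | 0 => 1
  | k1.+1 => match k1 with
             | 0 => 'X
             | k2.+1 => 'X * path_poly b k1 - (b k2 ^+ 2)%:P * path_poly b k2
             end
  end.

Lemma path_polySS (b : nat -> R) (k : nat) (x : R) :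
  (path_poly b k.+2).[x] =
    x * (path_poly b k.+1).[x] - b k ^+ 2 * (path_poly b k).[x].
Proof. by rewrite /= !(hornerE, hornerM). Qed.

(* Right of a point where all shorter polynomials are positive, the ratios of
   consecutive polynomials increase with slope at least 1. *)
Lemma path_poly_mono (b : nat -> R) (m : nat) (x y : R) :
    x <= y -> (forall k, (k <= m)%N -> 0 < (path_poly b k).[x]) ->
  forall k, (k <= m)%N -> 0 < (path_poly b k).[y] /\
    (y - x) * ((path_poly b k).[y] * (path_poly b k).[x]) <=
    (path_poly b k.+1).[y] * (path_poly b k).[x] -
    (path_poly b k.+1).[x] * (path_poly b k).[y].
Proof.
move=> xy px; elim=> [_|k IH km].
  by rewrite /= !(hornerC, hornerX) !mulr1 ltr01.
have [pk IHk] := IH (ltnW km).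
have xk := px _ (ltnW km); have xk1 := px _ km.
have yk1 : 0 < (path_poly b k.+1).[y].
  rewrite -(pmulr_lgt0 _ xk).
  have h1 : 0 < (path_poly b k.+1).[x] * (path_poly b k).[y] by apply: mulr_gt0.
  have h2 : 0 <= (y - x) * ((path_poly b k).[y] * (path_poly b k).[x]).
    by rewrite mulr_ge0 ?subr_ge0 // ltW // mulr_gt0.
  lra.
split=> //; rewrite !path_polySS.
have h2 : 0 <= (y - x) * ((path_poly b k).[y] * (path_poly b k).[x]).
  by rewrite mulr_ge0 ?subr_ge0 // ltW // mulr_gt0.
(* Christoffel-Darboux recursion: the right-hand difference at [k.+1] is
   [(y - x) p_{k+1}(y) p_{k+1}(x)] plus [b_k^2] times the nonnegative difference at [k]. *)
have := mulr_ge0 (sqr_ge0 (b k)) (le_trans h2 IHk).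
move: (path_poly b k.+1).[y] (path_poly b k.+1).[x] => p1 p2.
nra.
Qed.

(** At the root [x] given for [p_{m+1}], the recurrence makes [p_{m+2}] negative. A sign change
    further right yields the new root, and [path_poly_mono] carries positivity of the shorter
    polynomials there. *)
Lemma path_poly_top_root (b : nat -> R) (m : nat) :
    (forall k, (k < m)%N -> 0 < b k) ->
  exists x, [/\ 0 <= x, (path_poly b m.+1).[x] = 0 &
    forall k, (k <= m)%N -> 0 < (path_poly b k).[x]].
Proof.
elim: m => [_|m IH b0].
  by exists 0; split=> [||[]] //=; rewrite ?hornerX // hornerC ltr01.
have [|x [x0 xr px]] := IH; first by move=> k km; apply/b0/ltnW.
have bm := b0 _ (ltnSn m).
have xb : x <= x + b m by rewrite lerDl ltW.
have px2 : (path_poly b m.+2).[x] < 0.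
  by rewrite path_polySS xr mulr0 sub0r oppr_lt0 mulr_gt0 ?exprn_gt0 ?px.
have slope z : x <= z ->
    (z - x) * (path_poly b m).[z] <= (path_poly b m.+1).[z].
  move=> xz; have [_] := @path_poly_mono b m x z xz px m (leqnn m).
  by rewrite xr mul0r subr0 mulrA ler_pM2r // px.
(* The shift [b m] suffices: [slope] gives [p_{m+1} >= b_m p_m] at [x + b_m], so the recurrence
   leaves at least [x b_m p_m >= 0]. *)
have pxb : 0 <= (path_poly b m.+2).[x + b m].
  rewrite path_polySS.
  have [pm _] := @path_poly_mono b m x _ xb px m (leqnn m).
  have := slope _ xb; rewrite [x + _ - x]addrC addKr => h.
  have := ler_wpM2l (addr_ge0 x0 (ltW bm)) h.
  have : 0 <= x * (b m * (path_poly b m).[x + b m]) by rewrite !mulr_ge0 // ltW.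
  lra.
have [|z /andP[xz zb] /rootP zr] := @poly_ivt _ (path_poly b m.+2) _ _ xb.
  by rewrite (ltW px2) pxb.
have xz' : x < z.
  by rewrite lt_neqAle xz andbT; apply: contraTneq px2 => ->; rewrite zr ltxx.
exists z; split=> //; first exact: le_trans xz.
move=> k; rewrite leq_eqVlt => /predU1P[->|]; last first.
  by rewrite ltnS => km; have [] := @path_poly_mono b m x _ xz px k km.
apply: lt_le_trans (slope _ xz); rewrite mulr_gt0 ?subr_gt0 //.
by have [] := @path_poly_mono b m x _ xz px m (leqnn m).
Qed.

(** The values [p_l(x) / (b_0 ... b_{l-1})] solve the three-term recurrence, and [p_{j-i+1}(x) = 0]
    is the right end condition. Positivity bounds the spectral radius above by [x]; being an
    eigenvector bounds it below. *)
Lemma path_perron (i j : nat) :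
    (0 < i <= j)%N -> (forall k, (i <= k < j)%N -> 0 < a k) ->
  exists f : nat -> R,
    [/\ forall k, (i <= k <= j)%N -> 0 < f k, f i.-1 = 0, f j.+1 = 0 &
        forall k, (i <= k <= j)%N ->
          a k.-1 * f k.-1 + a k * f k.+1 = path_rho a i j * f k].
Proof.
move=> /andP[i0 ij] a0; pose b k := a (i + k)%N.
have [|x [x0 xr px]] := @path_poly_top_root b (j - i).
  by move=> k kji; apply: a0; lia.
pose B k := \prod_(l < k) b l.
have B0 k : (k <= j - i)%N -> 0 < B k.
  by move=> kji; apply: prodr_gt0 => l _; apply: a0; have := ltn_ord l; lia.
pose f k := if (k < i)%N then 0 else (path_poly b (k - i)).[x] / B (k - i)%N.
have f0 k : (i <= k <= j)%N -> 0 < f k.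
  move=> /andP[ik kj]; rewrite /f ltnNge ik /= divr_gt0 //.
    by apply: px; lia.
  by apply: B0; lia.
have fi : f i.-1 = 0 by rewrite /f ifT //; lia.
(* The denominator here contains [a j], whose sign is unknown; the vanishing numerator settles the
   value. *)
have fj : f j.+1 = 0.
  by rewrite /f ifF; [rewrite subSn // xr mul0r | lia].
have fx k : (i <= k <= j)%N -> a k.-1 * f k.-1 + a k * f k.+1 = x * f k.
  move=> /andP[ik kj].
  have step l : (l < j - i)%N ->
      b l * ((path_poly b l.+1).[x] / B l.+1) = (path_poly b l.+1).[x] / B l.
    move=> lji; have Bl := B0 l (ltnW lji).
    have bl : 0 < b l by apply: a0; lia.
    by rewrite /B big_ord_recr /= -/(B l); field; rewrite !gt_eqF.
  have fE l : f (i + l)%N = (path_poly b l).[x] / B l.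
    by rewrite /f ltnNge leq_addr /= addKn.
  have top l : (l <= j - i)%N ->
      a (i + l)%N * f (i + l).+1 = (path_poly b l.+1).[x] / B l.
    rewrite leq_eqVlt => /predU1P[->|lji]; last by rewrite -addnS fE step.
    by rewrite subnKC // fj xr mulr0 mul0r.
  have [l kE] : exists l, k = (i + l)%N by exists (k - i)%N; lia.
  subst k; have {kj}kj : (l <= j - i)%N by lia.
  rewrite top // fE; case: l kj {ik} => [|l] lji.
    by rewrite addn0 fi mulr0 add0r /= hornerX hornerC mul1r.
  rewrite addnS /= fE path_polySS.
  have -> : B l.+1 = B l * b l by rewrite /B big_ord_recr.
  have Bl := B0 l (ltnW lji); have bl : 0 < b l by apply: a0; lia.
  by rewrite -/(b l); field; rewrite !gt_eqF.
suff -> : path_rho a i j = x by exists f; split.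
apply/eqP; rewrite eq_le; apply/andP; split.
  by apply: (@path_rho_le _ _ _ f); rewrite ?fi ?fj ?mulr0 ?i0 //
    => k /fx ->.
have rng (p : 'I_(j - i).+1) : (i <= i + p <= j)%N by have := ltn_ord p; lia.
apply: (@le_spectral_radius _ _ _ _ (\row_p f (i + p)%N)) => //.
  apply/eqP => /rowP/(_ ord0); rewrite !mxE => /eqP.
  by rewrite gt_eqF // f0 ?rng.
apply/rowP => q; rewrite !mxE -fx ?rng // -(@sum_path_weight _ i j) ?rng //.
by apply: eq_bigr => p _; rewrite !mxE.
Qed.

(** * Monotone ratios of Perron vectors *)

(* The two sides are consecutive values of the discrete Wronskian of [g] and [h]. *)
Lemma wronskian_step (g h : nat -> R) (q s : R) (k : nat) :
    s <= q -> 0 < g k -> 0 < h k ->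
    a k.-1 * g k.-1 + a k * g k.+1 = q * g k ->
    a k.-1 * h k.-1 + a k * h k.+1 = s * h k ->
  a k * (g k * h k.+1 - g k.+1 * h k) <=
    a k.-1 * (g k.-1 * h k - g k * h k.-1).
Proof.
move=> sq gk hk gE hE.
have : s * (g k * h k) <= q * (g k * h k) by rewrite ler_wpM2r // mulr_ge0 ?ltW.
rewrite [q * (_ * _)]mulrA -gE [s * _]mulrCA -hE.
lra.
Qed.

(** The Wronskian starts at 0, since both vectors vanish at [i.-1], and cannot increase to the right
    because [s <= q]. *)
Lemma ratio_mono_left (g h : nat -> R) (q s : R) (i j : nat) :
    (0 < i)%N -> s <= q -> (forall k, (i <= k < j)%N -> 0 < a k) ->
    (forall k, (i <= k < j)%N -> 0 < g k /\ 0 < h k) ->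
    g i.-1 = 0 -> h i.-1 = 0 ->
    (forall k, (i <= k < j)%N -> a k.-1 * g k.-1 + a k * g k.+1 = q * g k /\
                                 a k.-1 * h k.-1 + a k * h k.+1 = s * h k) ->
  forall k, (i <= k < j)%N -> g k * h k.+1 <= g k.+1 * h k.
Proof.
move=> i0 sq a0 gh0 gi hi E k ikj; rewrite -subr_le0 -(pmulr_rle0 _ (a0 k ikj)).
have [l kE] : exists l, k = (i + l)%N by exists (k - i)%N; lia.
subst k; elim: l ikj => [|l IH] ikj; have [gk hk] := gh0 _ ikj;
  have [gE hE] := E _ ikj;
  apply: (le_trans (wronskian_step _ _ _ _ _ sq gk hk gE hE)).
  by rewrite addn0 gi hi mul0r mulr0 subrr mulr0.
by rewrite addnS /=; apply: IH; lia.
Qed.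

(** Here the Wronskian is 0 at [j] and cannot decrease when moving left, whence the induction on the
    distance to [j]. *)
Lemma ratio_mono_right (f h : nat -> R) (p s : R) (i j : nat) :
    s <= p -> (forall k, (i <= k <= j)%N -> 0 < a k) ->
    (forall k, (i < k <= j)%N -> 0 < f k /\ 0 < h k) ->
    f j.+1 = 0 -> h j.+1 = 0 ->
    (forall k, (i < k <= j)%N -> a k.-1 * f k.-1 + a k * f k.+1 = p * f k /\
                                 a k.-1 * h k.-1 + a k * h k.+1 = s * h k) ->
  forall k, (i <= k <= j)%N -> f k.+1 * h k <= f k * h k.+1.
Proof.
move=> sp a0 fh0 fj hj E k ikj; rewrite -subr_ge0 -(pmulr_rge0 _ (a0 k ikj)).
have [l lE] : exists l, l = (j - k)%N by exists (j - k)%N.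
elim: l k ikj lE => [|l IH] k ikj lE.
  have -> : k = j by lia.
  by rewrite fj hj mul0r mulr0 subrr mulr0.
have ikj1 : (i < k.+1 <= j)%N by lia.
have [fk hk] := fh0 _ ikj1; have [fE hE] := E _ ikj1.
apply: le_trans (wronskian_step _ _ _ _ _ sp fk hk fE hE); apply: IH; lia.
Qed.

End Path.

(** * Local inequalities for the test vector *)

(** Chebyshev's sum inequality with weights [Z], [Z'] for the oppositely ordered ratios [X / Z] and
    [Y / Z]; the defect factors into the two order hypotheses. *)
Lemma ratio_chebyshev (R : realFieldType) (X X' Y Y' Z Z' : R) :
    0 < Z -> 0 < Z' -> X' * Z <= X * Z' -> Y * Z' <= Y' * Z ->
  X * Y / Z + X' * Y' / Z' <= (X + X') * (Y + Y') / (Z + Z').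
Proof.
move=> Z0 Z'0 HX HY.
have ZZ0 : 0 < Z + Z' by rewrite addr_gt0.
rewrite -subr_ge0.
have -> : (X + X') * (Y + Y') / (Z + Z') - (X * Y / Z + X' * Y' / Z') =
    (X * Z' - X' * Z) * (Y' * Z - Y * Z') / (Z * Z' * (Z + Z')).
  by field; rewrite !gt_eqF.
by rewrite divr_ge0 ?mulr_ge0 ?subr_ge0 // ltW // mulr_gt0.
Qed.

(** With [r = g_2 / h_2], the right side is the left one times [(q / s)^2 >= 1]. *)
Lemma supersolution_end (R : realFieldType) (p q s a1 f1 f2 r : R) :
    0 < s -> s <= q -> 0 <= p * f1 -> 0 <= r -> a1 * f2 = p * f1 ->
  a1 * (f2 * r) <= p * q / s * (q / s * r * f1).
Proof.
move=> s0 sq pf r0 E; rewrite mulrA E.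
have -> : p * q / s * (q / s * r * f1) = p * f1 * r * (q / s) ^+ 2.
  by field; rewrite gt_eqF.
rewrite ler_peMr ?(mulr_ge0 pf) // exprn_ege1 //.
by rewrite ler_pdivlMr // mul1r.
Qed.

(** Since [g] and [h] vanish at the end vertex, [g_3 / h_3 = (q / s) (g_2 / h_2)]. The end value of
    [w] is thus [f_1 (g_3 / h_3)], and the equation of [f] at vertex 2 gives equality. *)
Lemma supersolution_next (R : realFieldType)
    (p q s a1 a2 f1 f2 f3 g2 g3 h2 h3 : R) :
    0 < s -> 0 < a2 -> 0 < h2 -> 0 < h3 ->
    a1 * f1 + a2 * f3 = p * f2 -> a2 * g3 = q * g2 -> a2 * h3 = s * h2 ->
  a1 * (q / s * (g2 / h2) * f1) + a2 * (f3 * (g3 / h3)) =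
    p * q / s * (f2 * (g2 / h2)).
Proof.
move=> s0 a20 h20 h30 fE gE hE.
have -> : g3 / h3 = q / s * (g2 / h2).
  by rewrite mulf_div -gE -hE; field; rewrite !gt_eqF.
have -> : p * q / s * (f2 * (g2 / h2)) = q / s * (g2 / h2) * (p * f2) by ring.
by rewrite -fE; ring.
Qed.

Lemma supersolution_inner (R : realFieldType)
    (p q s am ak fm fk fp gm gk gp hm hk hp : R) :
    0 < am -> 0 < ak -> 0 < hm -> 0 < hk -> 0 < hp ->
    am * fm + ak * fp = p * fk -> am * gm + ak * gp = q * gk ->
    am * hm + ak * hp = s * hk ->
    fk / hk <= fm / hm -> fp / hp <= fk / hk ->
    gm / hm <= gk / hk -> gk / hk <= gp / hp ->
  am * (fm * (gm / hm)) + ak * (fp * (gp / hp)) <=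
    p * q / s * (fk * (gk / hk)).
Proof.
move=> am0 ak0 hm0 hk0 hp0 fE gE hE f1 f2 g1 g2.
have s0 : 0 < s by rewrite -(pmulr_lgt0 _ hk0) -hE addr_gt0 ?mulr_gt0.
have -> : am * (fm * (gm / hm)) = (am * fm) * (am * gm) / (am * hm).
  by field; rewrite !gt_eqF.
have -> : ak * (fp * (gp / hp)) = (ak * fp) * (ak * gp) / (ak * hp).
  by field; rewrite !gt_eqF.
have -> : p * q / s * (fk * (gk / hk)) = (p * fk) * (q * gk) / (s * hk).
  by field; rewrite !gt_eqF.
rewrite -fE -gE -hE.
(* Only the two neighbours enter the sum, so their ratios are compared directly, skipping the middle
   vertex. *)
have fmp := le_trans f2 f1; have gmp := le_trans g1 g2.
rewrite ler_pdivrMr // mulrAC ler_pdivlMr // in fmp.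
rewrite ler_pdivrMr // mulrAC ler_pdivlMr // in gmp.
by apply: ratio_chebyshev; rewrite ?mulr_gt0 //;
  rewrite mulrACA [X in _ <= X]mulrACA [ak * _]mulrC ler_pM2l // mulr_gt0.
Qed.

(** * Assembly of the global inequality *)

Lemma path_rho_ge0 (R : realType) (a : nat -> R) (i j : nat) :
  0 <= path_rho a i j.
Proof.
have [[z _ zE] _] := spectral_radius_max (path_adj a i j).
by rewrite /path_rho -zE -lecR RRe_real ?normr_real // normr_ge0.
Qed.

Lemma path_rho_product_le (R : realType) (n : nat) (a f g h : nat -> R)
    (p q s : R) :
    (2 < n)%N -> (forall m, (1 <= m <= n)%N -> 0 < a m) ->
    0 < s -> s <= p -> s <= q ->
    (forall k, (1 <= k <= n)%N -> 0 < f k) ->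
    (forall k, (2 <= k <= n.+1)%N -> 0 < g k) ->
    (forall k, (2 <= k <= n)%N -> 0 < h k) ->
    f 0%N = 0 -> f n.+1 = 0 -> g 1%N = 0 -> g n.+2 = 0 ->
    h 1%N = 0 -> h n.+1 = 0 ->
    (forall k, (1 <= k <= n)%N ->
      a k.-1 * f k.-1 + a k * f k.+1 = p * f k) ->
    (forall k, (2 <= k <= n.+1)%N ->
      a k.-1 * g k.-1 + a k * g k.+1 = q * g k) ->
    (forall k, (2 <= k <= n)%N ->
      a k.-1 * h k.-1 + a k * h k.+1 = s * h k) ->
  path_rho a 1 n.+1 <= p * q / s.
Proof.
case: n => [|[|m]] // m0 ha s0 sp sq f0 g0 h0 fl fr gl gr hl hr fE gE hE.
pose n := m.+2; rewrite -/n in m0 ha f0 g0 h0 fr gr hr fE gE hE *.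
have r2 : (1 <= 2 <= n)%N by [].
have rn : (1 <= n <= n)%N by rewrite leqnn.
have rn'' : (2 <= n <= n.+1)%N by rewrite leqnSn.
have rm' : (2 <= n.-1 <= n)%N by rewrite /= leqnSn andbT.
have ih k : (2 <= k < n)%N -> (2 <= k <= n)%N /\ (2 <= k.+1 <= n)%N.
  by move=> kn; clear -kn; split; lia.
have fh k : (2 <= k < n)%N -> f k.+1 / h k.+1 <= f k / h k.
  move=> /[dup] kn /ih[kn1 kn2].
  rewrite ler_pdivrMr ?h0 // mulrAC ler_pdivlMr ?h0 //.
  apply: (@ratio_mono_right _ a f h p s 2 n sp _ _ fr hr) => // l ln.
  - by apply: ha; clear -ln; lia.
  - by split; [apply: f0 | apply: h0]; clear -ln; lia.
  - by split; [apply: fE | apply: hE]; clear -ln; lia.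
have gh k : (2 <= k < n)%N -> g k / h k <= g k.+1 / h k.+1.
  move=> /[dup] kn /ih[kn1 kn2].
  rewrite ler_pdivrMr ?h0 // mulrAC ler_pdivlMr ?h0 //.
  apply: (@ratio_mono_left _ a g h q s 2 n _ sq _ _ gl hl) => // l ln.
  - by apply: ha; clear -ln; lia.
  - by split; [apply: g0 | apply: h0]; clear -ln; lia.
  - by split; [apply: gE | apply: hE]; clear -ln; lia.
have [p0 q0] : 0 < p /\ 0 < q by split; apply: lt_le_trans s0 _.
(* The end values are chosen to give equality at vertices 2 and [n]; the zeros beyond make the
   boundary terms of [path_rho_le] vanish. *)
pose w k :=
  if k == 1%N then q / s * (g 2%N / h 2%N) * f 1%N
  else if (2 <= k <= n)%N then f k * (g k / h k)
  else if k == n.+1 then p / s * (f n / h n) * g n.+1 else 0.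
have w1 : w 1%N = q / s * (g 2%N / h 2%N) * f 1%N by [].
have wE k : (2 <= k <= n)%N -> w k = f k * (g k / h k).
  by move=> kn; rewrite /w kn; case: eqP kn => // ->.
have wn1 : w n.+1 = p / s * (f n / h n) * g n.+1.
  by rewrite /w ltnn eqxx andbF.
have w0 : w 0%N = 0 by [].
have wn2 : w n.+2 = 0.
  by rewrite /w !ifF //; clear; lia.
apply: (@path_rho_le _ a 1 n.+1 _ w) => [//|k kn|k kn|||k kn].
- exact: ha.
- have [->|[->|kn']] : k = 1%N \/ k = n.+1 \/ (2 <= k <= n)%N.
    by clear -kn; lia.
  + by rewrite w1 !(divr_gt0, mulr_gt0) ?f0 ?g0 ?h0.
  + by rewrite wn1 !(divr_gt0, mulr_gt0) ?f0 ?g0 ?h0.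
  + have kn1 : (1 <= k <= n)%N by clear -kn'; lia.
    have kn2 : (2 <= k <= n.+1)%N by clear -kn'; lia.
    by rewrite wE // !(divr_gt0, mulr_gt0) ?f0 ?g0 ?h0.
- by rewrite w0 mulr0.
- by rewrite wn2 mulr0.
have [->|[->|[->|[->|kn']]]] :
    k = 1%N \/ k = n.+1 \/ k = 2%N \/ k = n \/ (2 < k < n)%N.
  by clear -kn; lia.
- rewrite [_.-1]/= w0 mulr0 add0r w1 wE //.
  apply: supersolution_end => //; rewrite ?(divr_ge0, mulr_ge0) ?ltW ?f0 ?g0 ?h0 //.
  by rewrite -fE // [_.-1]/= fl mulr0 add0r.
(* Reflecting the path exchanges [f] with [g] and [p] with [q], so the left-end lemmas apply at
   [n.+1] and at [n]. *)
- rewrite [n.+1.-1]/= wn2 mulr0 addr0 wn1 wE // [f n * _]mulrCA [p * q]mulrC.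
  apply: supersolution_end => //; rewrite ?(divr_ge0, mulr_ge0) ?ltW ?f0 ?g0 ?h0 //.
  by rewrite -gE // [n.+1.-1]/= gr mulr0 addr0.
- rewrite [2.-1]/= w1 !wE // le_eqVlt; apply/orP; left; apply/eqP.
  apply: supersolution_next; rewrite ?ha ?h0 //.
  + exact: fE 2%N r2.
  + by rewrite -gE // [2.-1]/= gl mulr0 add0r.
  + by rewrite -hE // [2.-1]/= hl mulr0 add0r.
- rewrite wn1 !wE // le_eqVlt; apply/orP; left; apply/eqP.
  rewrite addrC [p * q]mulrC [f n * (g n / _)]mulrCA.
  rewrite [f n.-1 * _]mulrCA.
  apply: supersolution_next; rewrite ?ha ?h0 //.
  + by rewrite addrC gE.
  + by rewrite -fE // fr mulr0 addr0.
  + by rewrite -hE // hr mulr0 addr0.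
have [kn1 kn2 kn3 kn4 kn5] : [/\ (2 <= k < n)%N, (2 <= k.-1 < n)%N,
    (1 <= k <= n)%N, (1 <= k.-1 <= n)%N & (2 <= k <= n.+1)%N].
  by clear -kn'; split; lia.
have [[kn6 kn7] [kn8 _]] := (ih _ kn1, ih _ kn2).
have kE : k.-1.+1 = k by clear -kn'; lia.
rewrite !wE //; apply: supersolution_inner; rewrite ?ha ?h0 ?fE ?gE ?hE ?fh ?gh //.
  by rewrite -{1 2}kE fh.
by rewrite -{3 4}kE gh.
Qed.

Theorem lemma7p2 (R : realType) (n : nat) (a : nat -> R)
    (hn : (2 <= n)%N)
    (ha : forall m : nat, (1 <= m <= n)%N -> 0 < a m) :
  path_rho a 2 n * path_rho a 1 n.+1 <= path_rho a 1 n * path_rho a 2 n.+1.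
Proof.
(* For [n = 2] the interval [[2, n]] is one vertex with spectral radius 0, so one cannot divide by
   it, but the left side is 0. *)
have [n2|n3] : n = 2%N \/ (2 < n)%N by clear -hn; lia.
  by rewrite n2 path_rho_diag mul0r mulr_ge0 // path_rho_ge0.
have [|k kn|f [f0 fl fr fE]] := @path_perron _ a 1 n.
- by clear -hn; lia.
- by apply: ha; clear -kn; lia.
have [|k kn|g [g0 gl gr gE]] := @path_perron _ a 2 n.+1.
- by clear -hn; lia.
- by apply: ha; clear -kn; lia.
have [|k kn|h [h0 hl hr hE]] := @path_perron _ a 2 n.
- by clear -hn; lia.
- by apply: ha; clear -kn; lia.
have r1 : (1 <= 1 <= n)%N by clear -hn; lia.
have rn : (1 <= n <= n)%N by clear -hn; lia.
have r2' : (2 <= 2 <= n)%N by clear -hn; lia.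
(* The longer path's Perron vector is a supersolution on [[2, n]]; its value at vertex 1 only adds a
   nonnegative boundary term. *)
have sp : path_rho a 2 n <= path_rho a 1 n.
  apply: (@path_rho_le _ a 2 n _ f) => [|k kn|k kn|||k kn].
  - by clear -hn; lia.
  - by apply: ha; clear -kn; lia.
  - by apply: f0; clear -kn; lia.
  - by rewrite mulr_ge0 // ltW // ?ha ?f0.
  - by rewrite fr mulr0.
  - by rewrite fE //; clear -kn; lia.
have sq : path_rho a 2 n <= path_rho a 2 n.+1.
  apply: (@path_rho_le _ a 2 n _ g) => [|k kn|k kn|||k kn].
  - by clear -hn; lia.
  - by apply: ha; clear -kn; lia.
  - by apply: g0; clear -kn; lia.
  - by rewrite gl mulr0.
  - by rewrite mulr_ge0 // ltW // ?ha ?g0.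
  - by rewrite gE //; clear -kn; lia.
have s0 : 0 < path_rho a 2 n.
  rewrite -(pmulr_lgt0 _ (h0 2%N r2')) -hE // hl mulr0 add0r.
  by rewrite mulr_gt0 ?ha ?h0.
rewrite mulrC -ler_pdivlMr //.
exact: (@path_rho_product_le _ n a f g h).
Qed.
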